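(* Let $i,j\in\{1,\ldots,5\}$ with $i\neq j$, and let $A\in\mathsf{L}_i\oplus\mathsf{L}_j$ be an orthogonal matrix. Then $A\in\mathcal{OP}_4$.
   Context: For a permutation $\sigma$ of $\{1,2,3,4\}$, $P_\sigma$ is the permutation matrix with $(i,j)$ entry $1$ if $\sigma(i)=j$ and $0$ otherwise. $\mathcal{OP}_4$ is the set of $4\times4$ matrices $A$ with $A^TA=I$ that are permutative (each row is a permutation of any other row). $\mathsf{L}_k$ ($k=1,\ldots,5$) is the real span of $\mathcal{B}_k$, where $\mathcal{B}_1=\{P_{(12)},P_{(34)},P_{(13)(24)},P_{(14)(23)}\}$, $\mathcal{B}_2=\{P_{(24)},P_{(12)(34)}\}$, $\mathcal{B}_3=\{P_{(124)},P_{(234)}\}$, $\mathcal{B}_4=\{P_{(123)}\}$, $\mathcal{B}_5=\{P_{(23)}\}$. The union of the $\mathcal{B}_k$ is a basis of the $10$-dimensional real space of linear combinations of $4\times4$ permutation matrices, so sums of distinct $\mathsf{L}_k$ are direct. Cycles such as $(124)$ mean $1\mapsto2\mapsto4\mapsto1$. *)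

(* Defs.v *)
From HB Require Import structures.
From mathcomp Require Import all_boot all_order all_fingroup all_algebra.
From mathcomp Require Import reals.

Set Implicit Arguments.
Unset Strict Implicit.
Unset Printing Implicit Defensive.

Import GRing.Theory.
Local Open Scope ring_scope.

Definition permutative (R : realType) (n : nat) (A : 'M[R]_n) : Prop :=
  forall i j : 'I_n, exists s : 'S_n, row j A = col_perm s (row i A).

Definition orthogonal_mx (R : realType) (n : nat) (A : 'M[R]_n) : Prop :=
  A^T *m A = 1%:M.

Definition OP (R : realType) (n : nat) (A : 'M[R]_n) : Prop :=
  orthogonal_mx A /\ permutative A.

(* The points 1, 2, 3, 4 as elements of 'I_4 (which is 0-based). *)
Definition p1 : 'I_4 := @Ordinal 4 0 isT.
Definition p2 : 'I_4 := @Ordinal 4 1 isT.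
Definition p3 : 'I_4 := @Ordinal 4 2 isT.
Definition p4 : 'I_4 := @Ordinal 4 3 isT.

(* The product in 'S_4 applies its left factor first, so for distinct a, b, c
   this is the cycle a |-> b |-> c |-> a. *)
Definition cycle3 (a b c : 'I_4) : 'S_4 := (tperm a b * tperm a c)%g.

Definition perms (k : nat) : seq 'S_4 :=
  match k with
  | 1 => [:: tperm p1 p2; tperm p3 p4;
             (tperm p1 p3 * tperm p2 p4)%g; (tperm p1 p4 * tperm p2 p3)%g]
  | 2 => [:: tperm p2 p4; (tperm p1 p2 * tperm p3 p4)%g]
  | 3 => [:: cycle3 p1 p2 p4; cycle3 p2 p3 p4]
  | 4 => [:: cycle3 p1 p2 p3]
  | 5 => [:: tperm p2 p3]
  | _ => [::]
  end.

(* perm_mx s has entry (i, j) equal to 1 if s i = j and to 0 otherwise. *)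
Definition B (R : realType) (k : nat) : seq 'M[R]_4 :=
  [seq perm_mx s | s <- perms k].

Definition L (R : realType) (k : nat) : {vspace 'M[R]_4} := <<B R k>>%VS.

(* Main.v *)
(** Comparing the norms of the rows of an orthogonal [A] in [L_i + L_j] (and, for some pairs, norms of columns or scalar products of two rows) yields equations [x * y = x * z] in the coefficients of [A].  Each one either kills a coefficient or identifies two of them, and in each resulting case the rows of [A] are visibly rearrangements of each other. *)
Require Import Defs.
From HB Require Import structures.
From mathcomp Require Import all_boot all_order all_fingroup all_algebra.
From mathcomp Require Import reals lra zify.
Import GRing.Theory.
Local Open Scope ring_scope.

(** [lra] treats products of coefficients as atoms, so it can only deliver equations between
    monomials; this turns them into case distinctions. *)
Lemma mulfI_or0 {F : idomainType} {x y z : F} : x * y = x * z -> x = 0 \/ y = z.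
Proof.
by move/eqP; rewrite -subr_eq0 -mulrBr mulf_eq0 subr_eq0 => /orP[]/eqP; [left|right].
Qed.

Lemma mulf0_or {F : idomainType} {x y : F} : x * y = 0 -> x = 0 \/ y = 0.
Proof. by move/eqP; rewrite mulf_eq0 => /orP[]/eqP; [left|right]. Qed.

Lemma big_ord4 (T : nmodType) (F : 'I_4 -> T) :
  \sum_x F x = F p1 + F p2 + F p3 + F p4.
Proof.
rewrite !big_ord_recr big_ord0 /= add0r.
by congr (F _ + F _ + F _ + F _); apply: val_inj.
Qed.

Lemma ord4_ind (P : 'I_4 -> Prop) : P p1 -> P p2 -> P p3 -> P p4 -> forall x, P x.
Proof.
move=> P1 P2 P3 P4 [[|[|[|[|//]]]] lt4].
- by rewrite (_ : Ordinal _ = p1) //; apply: val_inj.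
- by rewrite (_ : Ordinal _ = p2) //; apply: val_inj.
- by rewrite (_ : Ordinal _ = p3) //; apply: val_inj.
- by rewrite (_ : Ordinal _ = p4) //; apply: val_inj.
Qed.

Definition mx4 {R : realType} (s : seq (seq R)) : 'M[R]_4 :=
  \matrix_(x, y) nth 0 (nth [::] s x) y.

Lemma add_mx4E {R : realType} (s t : seq (seq R)) (x y : 'I_4) :
  (mx4 s + mx4 t) x y = nth 0 (nth [::] s x) y + nth 0 (nth [::] t x) y.
Proof. by rewrite !mxE. Qed.

(** * Orthonormal rows and columns, and permutativity as equality of multisets *)

Section Orthogonal.
Variables (R : realType) (A : 'M[R]_4).

(** The hypothesis is about columns, but a left inverse of a square matrix is also a right
    inverse. *)
Lemma orthogonal_rows (hO : orthogonal_mx A) (x z : 'I_4) :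
  A x p1 * A z p1 + A x p2 * A z p2 + A x p3 * A z p3 + A x p4 * A z p4
  = (x == z)%:R.
Proof.
have /matrixP/(_ x z) := mulmx1C hO.
by rewrite !mxE big_ord4 !mxE.
Qed.

Lemma orthogonal_cols (hO : orthogonal_mx A) (x z : 'I_4) :
  A p1 x * A p1 z + A p2 x * A p2 z + A p3 x * A p3 z + A p4 x * A p4 z
  = (x == z)%:R.
Proof.
have /matrixP/(_ x z) := hO.
by rewrite !mxE big_ord4 !mxE.
Qed.

Definition row_seq (x : 'I_4) := [:: A x p1; A x p2; A x p3; A x p4].

(** Having the same multiset of entries is an equivalence relation, so the first row serves as
    reference, and no permutation has to be exhibited. *)
Lemma permutative_row_seq :
  perm_eq (row_seq p2) (row_seq p1) -> perm_eq (row_seq p3) (row_seq p1) ->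
  perm_eq (row_seq p4) (row_seq p1) -> permutative A.
Proof.
move=> h2 h3 h4 x z.
have to1 : forall x, perm_eq (row_seq x) (row_seq p1) by apply: ord4_ind.
have hxz : perm_eq (row_seq z) (row_seq x).
  by apply: (perm_trans (to1 z)); rewrite perm_sym.
have row_nth t (y : 'I_4) : A t y = nth 0 (row_seq t) y by move: y; apply: ord4_ind.
have /tuple_permP[s hs] : perm_eq (row_seq z) [tuple A x p1; A x p2; A x p3; A x p4] by [].
exists s; apply/rowP=> y; rewrite !mxE (row_nth z) hs /= (nth_map y) ?size_enum_ord //.
by rewrite nth_ord_enum (tnth_nth 0) row_nth.
Qed.

End Orthogonal.

(** * Explicit matrices for the five spans *)

Section Spans.
Variables (R : realType) (A : 'M[R]_4).

Ltac entries :=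
  apply/matrixP; apply: ord4_ind; apply: ord4_ind;
  rewrite !mxE /= !(permM, permE) /= ?(mulr1, mulr0, add0r, addr0) //.

(** The coefficients follow the order of [perms 1]. The four permutation matrices have disjoint
    supports covering all positions, so the result is a Latin square in [a], [b], [c], [d]. *)
Lemma mem_L1 : A \in L R 1 -> exists a b c d, A = mx4
  [:: [:: b; a; c; d]; [:: a; b; d; c]; [:: c; d; a; b]; [:: d; c; b; a]].
Proof.
rewrite /L /B /= !span_cons span_nil addv0.
move=> /memv_addP[_ /vlineP[a ->] [_ /memv_addP[_ /vlineP[b ->] [_ /memv_addP[_ /vlineP[c ->] [_ /vlineP[d ->] ->]] ->]] ->]].
by exists a, b, c, d; entries.
Qed.

Lemma mem_L2 : A \in L R 2 -> exists e f, A = mx4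
  [:: [:: e; f; 0; 0]; [:: f; 0; 0; e]; [:: 0; 0; e; f]; [:: 0; e; f; 0]].
Proof.
rewrite /L /B /= !span_cons span_nil addv0.
move=> /memv_addP[_ /vlineP[e ->] [_ /vlineP[f ->] ->]].
by exists e, f; entries.
Qed.

Lemma mem_L3 : A \in L R 3 -> exists g h, A = mx4
  [:: [:: h; g; 0; 0]; [:: 0; 0; h; g]; [:: 0; 0; g; h]; [:: g; h; 0; 0]].
Proof.
rewrite /L /B /= !span_cons span_nil addv0.
move=> /memv_addP[_ /vlineP[g ->] [_ /vlineP[h ->] ->]].
by exists g, h; entries.
Qed.

Lemma mem_L4 : A \in L R 4 -> exists u, A = mx4
  [:: [:: 0; u; 0; 0]; [:: 0; 0; u; 0]; [:: u; 0; 0; 0]; [:: 0; 0; 0; u]].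
Proof.
rewrite /L /B /= span_seq1 => /vlineP[u ->].
by exists u; entries.
Qed.

Lemma mem_L5 : A \in L R 5 -> exists v, A = mx4
  [:: [:: v; 0; 0; 0]; [:: 0; 0; v; 0]; [:: 0; v; 0; 0]; [:: 0; 0; 0; v]].
Proof.
rewrite /L /B /= span_seq1 => /vlineP[v ->].
by exists v; entries.
Qed.

End Spans.

Ltac orthogonality hO :=
  have := (orthogonal_rows _ _ hO p1 p1, orthogonal_rows _ _ hO p2 p2,
           orthogonal_rows _ _ hO p3 p3, orthogonal_rows _ _ hO p4 p4,
           orthogonal_rows _ _ hO p1 p2, orthogonal_rows _ _ hO p1 p3,
           orthogonal_rows _ _ hO p1 p4, orthogonal_rows _ _ hO p2 p3,
           orthogonal_cols _ _ hO p1 p1, orthogonal_cols _ _ hO p2 p2,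
           orthogonal_cols _ _ hO p3 p3, orthogonal_cols _ _ hO p4 p4);
  rewrite !add_mx4E /= ?(add0r, addr0, mul0r, mulr0);
  move=> [[[[[[[[[[[n1 n2] n3] n4] d12] d13] d14] d23] m1] m2] m3] m4];
  clear hO.

(** Two lists are rearrangements of each other when every predicate has the same count on both; for
    explicit lists this is a linear identity between truth values, within reach of [lia]. *)
Ltac permute_rows :=
  apply: permutative_row_seq;
  rewrite /row_seq !add_mx4E /= ?(add0r, addr0); apply/seq.permP=> ? /=; lia.

(** * The ten pairs of spans *)

Section Pairs.
Variable R : realType.
Implicit Types X Y : 'M[R]_4.

Lemma permutative_L12 X Y : X \in L R 1 -> Y \in L R 2 ->
  orthogonal_mx (X + Y) -> permutative (X + Y).
Proof.
move=> /mem_L1[a [b [c [d ->]]]] /mem_L2[e [f ->]] hO; orthogonality hO.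
(* Rows 1, 2 give [e * b = e * c] and rows 3, 4 give [e * a = e * c]; the norms of rows 1, 3 then
   leave [f * a = f * b]. *)
have /mulfI_or0[e0|bc] : e * b = e * c by lra.
all: have /mulfI_or0[f0|ab] : f * a = f * b by lra.
all: have /mulfI_or0 : e * b = e * a by lra.
all: case=> ?; subst; permute_rows.
Qed.

Lemma permutative_L13 X Y : X \in L R 1 -> Y \in L R 3 ->
  orthogonal_mx (X + Y) -> permutative (X + Y).
Proof.
move=> /mem_L1[a [b [c [d ->]]]] /mem_L3[g [h ->]] hO; orthogonality hO.
(* Rows 1 and 3 have the same entries, so row norms are too weak here; comparing row 1 with each of
   the four columns isolates the products. *)
have /mulfI_or0 ad : g * a = g * d by lra.
have /mulfI_or0 ac : g * a = g * c by lra.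
have /mulfI_or0 bc : h * b = h * c by lra.
have /mulfI_or0 bd : h * b = h * d by lra.
clear -ad ac bc bd.
by case: ad ac bc bd => ? [] ? [] ? [] ?; subst; permute_rows.
Qed.

(** In rows 1 to 4, [u] is added to [a], [d], [c], [a], so the squared norms differ only in
    [2 * u * a], [2 * u * d], [2 * u * c], [2 * u * a]. *)
Lemma permutative_L14 X Y : X \in L R 1 -> Y \in L R 4 ->
  orthogonal_mx (X + Y) -> permutative (X + Y).
Proof.
move=> /mem_L1[a [b [c [d ->]]]] /mem_L4[u ->] hO; orthogonality hO.
have /mulfI_or0[?|?] : u * a = u * d by lra.
all: have /mulfI_or0[?|?] : u * a = u * c by lra.
all: subst; permute_rows.
Qed.

Lemma permutative_L15 X Y : X \in L R 1 -> Y \in L R 5 ->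
  orthogonal_mx (X + Y) -> permutative (X + Y).
Proof.
move=> /mem_L1[a [b [c [d ->]]]] /mem_L5[v ->] hO; orthogonality hO.
have /mulfI_or0[?|?] : v * a = v * b by lra.
all: have /mulfI_or0[?|?] : v * a = v * d by lra.
all: subst; permute_rows.
Qed.

Lemma permutative_L23 X Y : X \in L R 2 -> Y \in L R 3 ->
  orthogonal_mx (X + Y) -> permutative (X + Y).
Proof.
move=> /mem_L2[e [f ->]] /mem_L3[g [h ->]] hO; orthogonality hO.
have /mulf0_or fg : f * g = 0 by lra.
have /mulf0_or fh : f * h = 0 by lra.
(* Rows 1, 2 have scalar product [f * (e + h)], rows 1, 4 [(e + h) * (f + 2 * g)], and rows 2, 3
   [(e + g) * (f + 2 * h)]. *)
have /mulf0_or feh : f * (e + h) = 0 by lra.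
have /mulf0_or geh : g * (e + h) = 0 by lra.
have /mulf0_or heg : h * (e + g) = 0 by lra.
(* A nonzero [f] kills [g], [h] and then [e], leaving a multiple of $P_{(12)(34)}$. *)
have [?|f0] := eqVneq f 0; last first.
  case: fg => [/eqP|g0]; first by rewrite (negPf f0).
  case: fh => [/eqP|h0]; first by rewrite (negPf f0).
  case: feh => [/eqP|]; first by rewrite (negPf f0).
  by rewrite h0 addr0 => e0; subst; permute_rows.
case: geh heg => [?|he] [?|ge]; subst.
- permute_rows.
- have ? : e = 0 by lra.
  by subst; permute_rows.
- have ? : e = 0 by lra.
  by subst; permute_rows.
(* The exceptional case: $P_{(124)} + P_{(234)} - P_{(24)} = P_{(1234)}$, so the matrix is [h] times
   a permutation matrix outside the basis. *)
- have ? : g = h by lra.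
  have ? : e = - h by lra.
  by subst; permute_rows.
Qed.

(** Here and in the remaining pairs all products of two distinct coefficients vanish, by row norms
    and scalar products of rows, so the matrix is a multiple of a single basis element. *)
Lemma permutative_L24 X Y : X \in L R 2 -> Y \in L R 4 ->
  orthogonal_mx (X + Y) -> permutative (X + Y).
Proof.
move=> /mem_L2[e [f ->]] /mem_L4[u ->] hO; orthogonality hO.
have /mulf0_or fu : f * u = 0 by lra.
have /mulf0_or ef : e * f = 0 by lra.
have /mulf0_or eu : e * u = 0 by lra.
by case: fu ef eu => ? [] ? [] ?; subst; permute_rows.
Qed.

Lemma permutative_L25 X Y : X \in L R 2 -> Y \in L R 5 ->
  orthogonal_mx (X + Y) -> permutative (X + Y).
Proof.
move=> /mem_L2[e [f ->]] /mem_L5[v ->] hO; orthogonality hO.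
have /mulf0_or ev : e * v = 0 by lra.
have /mulf0_or ef : e * f = 0 by lra.
have /mulf0_or fv : f * v = 0 by lra.
by case: ev ef fv => ? [] ? [] ?; subst; permute_rows.
Qed.

Lemma permutative_L34 X Y : X \in L R 3 -> Y \in L R 4 ->
  orthogonal_mx (X + Y) -> permutative (X + Y).
Proof.
move=> /mem_L3[g [h ->]] /mem_L4[u ->] hO; orthogonality hO.
have /mulf0_or gu : g * u = 0 by lra.
have /mulf0_or hu : h * u = 0 by lra.
have /mulf0_or gh : g * h = 0 by lra.
by case: gu hu gh => ? [] ? [] ?; subst; permute_rows.
Qed.

Lemma permutative_L35 X Y : X \in L R 3 -> Y \in L R 5 ->
  orthogonal_mx (X + Y) -> permutative (X + Y).
Proof.
move=> /mem_L3[g [h ->]] /mem_L5[v ->] hO; orthogonality hO.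
have /mulf0_or gv : g * v = 0 by lra.
have /mulf0_or hv : h * v = 0 by lra.
have /mulf0_or gh : g * h = 0 by lra.
by case: gv hv gh => ? [] ? [] ?; subst; permute_rows.
Qed.

Lemma permutative_L45 X Y : X \in L R 4 -> Y \in L R 5 ->
  orthogonal_mx (X + Y) -> permutative (X + Y).
Proof.
move=> /mem_L4[u ->] /mem_L5[v ->] hO; orthogonality hO.
have /mulf0_or[?|?] : u * v = 0 by lra.
all: subst; permute_rows.
Qed.

Lemma permutative_sum (i j : nat) X Y : (1 <= i)%N -> (i < j)%N -> (j <= 5)%N ->
  X \in L R i -> Y \in L R j -> orthogonal_mx (X + Y) -> permutative (X + Y).
Proof.
case: i j => [|[|[|[|[|i]]]]] [|[|[|[|[|[|j]]]]]] // _ _ _.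
- exact: permutative_L12.
- exact: permutative_L13.
- exact: permutative_L14.
- exact: permutative_L15.
- exact: permutative_L23.
- exact: permutative_L24.
- exact: permutative_L25.
- exact: permutative_L34.
- exact: permutative_L35.
- exact: permutative_L45.
Qed.

End Pairs.

Theorem theorem3p7 (R : realType) (i j : nat) (hi : (1 <= i <= 5)%N)
    (hj : (1 <= j <= 5)%N) (hij : i <> j) (A : 'M[R]_4)
    (hA : A \in (L R i + L R j)%VS) (hO : orthogonal_mx A) :
  OP A.
Proof.
split=> //.
have /memv_addP[X hX [Y hY eA]] := hA; subst A.
case/andP: hi hj => i1 i5 /andP[j1 j5].
case: (ltngtP i j) => // [lt_ij|lt_ji].
- exact: (@permutative_sum R i j).
(* The ten pairs were treated with the smaller index first; the other order is the same sum
   commuted. *)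
- by move: hO; rewrite addrC; apply: (@permutative_sum R j i).
Qed.
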